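(* (Representation Theorem) Every bounded distributive meet semi-lattice $L$ is isomorphic to $(L_* )^*$; that is, for each bounded distributive meet semi-lattice $L$ there exists a generalized Priestley space $X$ such that $L$ is isomorphic (as a bounded meet semi-lattice) to $\langle X^*,\cap,X,\emptyset\rangle$.
   Context: A meet semi-lattice is a poset in which any two elements have a greatest lower bound $\wedge$; it is distributive if whenever $b_1\wedge b_2\leq a$ there exist $c_1\ge b_1$, $c_2\ge b_2$ with $a=c_1\wedge c_2$; bounded means it has top and bottom. A filter is a nonempty upset closed under $\wedge$; a prime filter is a filter $F\ne L$ such that for all filters $F_1,F_2$ with $F_1\cap F_2\subseteq F$ we have $F_1\subseteq F$ or $F_2\subseteq F$. $L_+$ is the set of prime filters, $\sigma(a)=\{y\in L_+:a\in y\}$, $D(L)$ the sublattice of the powerset of $L_+$ of all finite unions of sets $\sigma(a)$. A filter $G$ is optimal if $G=\sigma^{-1}(P)$ for a prime filter $P$ of the lattice $D(L)$; $L_*$ is the set of optimal filters, $\phi(a)=\{y\in L_*:a\in y\}$, $\tau$ the topology on $L_*$ generated by the subbasis $\{\phi(a)\}\cup\{L_*-\phi(b)\}$, and $L_*$ also denotes the quadruple $\langle L_*,\tau,\subseteq,L_+\rangle$. A Priestley space is a compact space with a partial order $\le$ such that if $x\not\le y$ there is a clopen upset containing $x$ and not $y$. For $X=\langle X,\tau,\le,X_0\rangle$ with $\langle X,\tau,\le\rangle$ a Priestley space and $X_0\subseteq X$, $X^*$ is the set of clopen upsets $U$ with $\mathrm{max}(X-U)\subseteq X_0$, and $\mathcal{I}_x=\{U\in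 X^*:x\notin U\}$. $X$ is a generalized Priestley space if: $X_0$ is dense; every $x$ lies below some $y\in X_0$; $x\in X_0$ iff for all $U,V\in\mathcal{I}_x$ there is $W\in\mathcal{I}_x$ with $U\cup V\subseteq W$; and $x\le y$ iff every $U\in X^*$ containing $x$ contains $y$. *)

(* Defs.v *)
From HB Require Import structures.
From mathcomp Require Import all_boot all_order.
From mathcomp Require Import all_classical all_reals all_analysis.
Set Implicit Arguments.
Unset Strict Implicit.
Unset Printing Implicit Defensive.
Import Order.TTheory.
Local Open Scope classical_set_scope.

Section MeetSemilattice.
Context {d : Order.disp_t} {L : meetSemilatticeType d}.

Definition is_filter (F : set L) : Prop :=
  [/\ F !=set0,
      forall a b, F a -> (a <= b)%O -> F b
    & forall a b, F a -> F b -> F (Order.meet a b)].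

Definition prime_filter (F : set L) : Prop :=
  [/\ is_filter F, F <> [set: L]
    & forall F1 F2 : set L, is_filter F1 -> is_filter F2 ->
        F1 `&` F2 `<=` F -> F1 `<=` F \/ F2 `<=` F].

End MeetSemilattice.

Definition distributive_meet (d : Order.disp_t) (L : meetSemilatticeType d) :
    Prop :=
  forall a b1 b2 : L, (Order.meet b1 b2 <= a)%O ->
    exists c1 c2 : L, [/\ (b1 <= c1)%O, (b2 <= c2)%O & a = Order.meet c1 c2].

Section Dual.
Context {d : Order.disp_t} {L : meetSemilatticeType d}.

(* Subsets of L_+ are represented as sets of prime filters, i.e. as elements
   of [set (set L)], so that the order, meet and join of the powerset of L_+
   are those of [set (set L)]. *)
Definition sigma (a : L) : set (set L) := [set y | prime_filter y /\ y a].

Definition sigma_unions : set (set (set L)) :=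
  [set U | exists s : seq L, U = \bigcup_(a in [set` s]) sigma a].

Lemma sigmaI a b : sigma a `&` sigma b = sigma (Order.meet a b).
Proof.
apply/seteqP; split=> y /=.
  by case=> -[py ya] [_ yb]; split=> //; case: py => -[_ _ yI] _ _; exact: yI.
move=> [py yab]; case: (py) => -[_ yS _] _ _.
by split; split=> //; apply: yS yab _; [exact: leIl | exact: leIr].
Qed.

Lemma sigma_unionsI :
  {in sigma_unions &, forall U V, Order.meet U V \in sigma_unions}.
Proof.
move=> U V /set_mem[s ->] /set_mem[t ->]; apply/mem_set.
exists [seq Order.meet a b | a <- s, b <- t].
apply/seteqP; split=> y /=.
  move=> [[a sa ya] [b tb yb]].
  exists (Order.meet a b); first exact/allpairsP/(ex_intro _ (a, b)).
  by rewrite -sigmaI.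
by move=> [c /allpairsP[[a b] /= [sa tb ->]]]; rewrite -sigmaI => -[ya yb]; split;
  [exists a | exists b].
Qed.

Lemma sigma_unionsU :
  {in sigma_unions &, forall U V, Order.join U V \in sigma_unions}.
Proof.
move=> U V /set_mem[s ->] /set_mem[t ->]; apply/mem_set; exists (s ++ t).
apply/seteqP; split=> y /=.
  by move=> [] [a sa ya]; exists a => //=; rewrite mem_cat sa ?orbT.
by move=> [a]; rewrite /= mem_cat => /orP[] sa ya; [left|right]; exists a.
Qed.

Lemma sigma_in_unions a : sigma a \in sigma_unions.
Proof.
apply/mem_set; exists [:: a]; apply/seteqP; split=> y /=.
  by move=> ya; exists a => //=; rewrite mem_head.
by move=> [b /=]; rewrite inE => /eqP ->.
Qed.

End Dual.

Section DLattice.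
Context {d : Order.disp_t} (L : meetSemilatticeType d).

Definition DL : Type := set_type (@sigma_unions d L).

HB.instance Definition _ := SubChoice.on DL.
HB.instance Definition _ := Order.SubChoice_isSubLattice.Build _ _ _ set_display
  DL (@sigma_unionsI d L) (@sigma_unionsU d L).

Definition sigmaD (a : L) : DL := exist _ (sigma a) (sigma_in_unions a).

Definition optimal_filter (G : set L) : Prop :=
  is_filter G /\ exists2 P : set DL, prime_filter P & G = sigmaD @^-1` P.

Definition dual_space : Type := set_type optimal_filter.

HB.instance Definition _ := SubChoice.on dual_space.

Definition phi (a : L) : set dual_space := [set y | (val y : set L) a].

Definition dual_subbasis : set (set dual_space) :=
  range phi `|` range (fun b => ~` phi b).

HB.instance Definition _ :=
  isSubBaseTopological.Build dual_space dual_subbasis id.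

End DLattice.

Record marked_ordered_space := MarkedOrderedSpace {
  mos_space :> topologicalType;
  mos_le : mos_space -> mos_space -> Prop;
  mos_sub : set mos_space }.

Section GeneralizedPriestley.
Variable X : marked_ordered_space.
Local Notation le := (@mos_le X).
Local Notation X0 := (@mos_sub X).

Definition upset (U : set X) : Prop := forall x y, U x -> le x y -> U y.

Definition maximal (S : set X) : set X :=
  [set x | S x /\ forall y, S y -> le x y -> y = x].

Definition Priestley_space : Prop :=
  [/\ compact [set: X],
      [/\ forall x, le x x,
          forall x y, le x y -> le y x -> x = y
        & forall x y z, le x y -> le y z -> le x z]
    & forall x y, ~ le x y -> exists U, [/\ clopen U, upset U, U x & ~ U y]].

Definition star : set (set X) :=
  [set U | [/\ clopen U, upset U & maximal (~` U) `<=` X0]].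

Definition star_avoiding (x : X) : set (set X) := [set U | star U /\ ~ U x].

Definition generalized_Priestley_space : Prop :=
  [/\ Priestley_space,
      dense X0,
      forall x, exists2 y, X0 y & le x y,
      forall x, X0 x <->
        (forall U V, star_avoiding x U -> star_avoiding x V ->
           exists2 W, star_avoiding x W & U `|` V `<=` W)
    & forall x y, le x y <-> (forall U, star U -> U x -> U y)].

(* Isomorphism of bounded meet semi-lattices between L and
   <X^*, intersection, X, empty set>. *)
Definition iso_star (d : Order.disp_t) (L : tbMeetSemilatticeType d) : Prop :=
  exists f : L -> set X,
    [/\ set_bij [set: L] star f,
        forall a b, f (Order.meet a b) = f a `&` f b,
        f (@Order.top d L) = [set: X]
      & f (@Order.bottom d L) = set0].

End GeneralizedPriestley.

Definition dual (d : Order.disp_t) (L : meetSemilatticeType d) :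
    marked_ordered_space :=
  @MarkedOrderedSpace (dual_space L)
    (fun x y => (val x : set L) `<=` val y)
    [set x | prime_filter (val x : set L)].

(* Main.v *)
(** Optimal filters admit a description that does not mention [DL]: a filter
    [G] is optimal iff for every [a] in [G] and every finite [s] disjoint from
    [G], some upper bound of [s] is not above [a].  Prime filters are those for
    which the upper bound can even be chosen outside [G].  The description is
    an intersection of closed conditions, which yields compactness of the dual
    space, and it is stable under unions of chains, which yields maximal
    elements above every point of the complement of a clopen upset.  With
    [U = phi a1 `|` ... `|` phi an] a clopen upset whose complement has only
    prime maximal elements, primality shows that [U] is the intersection of the
    [phi c] for [c] a common upper bound of the [ai]; by compactness one such
    [c] suffices. *)
Require Import Defs.
From mathcomp Require Import all_boot all_order.
From mathcomp Require Import all_classical all_reals all_analysis.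
Set Implicit Arguments.
Unset Strict Implicit.
Unset Printing Implicit Defensive.
Import Order.TTheory.
Local Open Scope classical_set_scope.

(** * Zorn's lemma and compactness for directed families *)

(** Zorn's lemma is applied to the sets [A] with [P (x]|[A)], so that the empty chain is bounded
    thanks to [P x]; nonempty chains use the closure hypothesis. *)
Lemma Zorn_above (T : Type) (P : set (set T)) (x : set T) : P x ->
  (forall F : set (set T), F !=set0 -> F `<=` P -> total_on F subset ->
     P (\bigcup_(X in F) X)) ->
  exists z, [/\ x `<=` z, P z & forall w, z `<=` w -> P w -> w = z].
Proof.
move=> Px chainP.
have [|A [PA maxA]] := @Zorn_bigcup T [set A | P (x `|` A)].
  move=> F FP totF /=; have [[X FX]|F0] := pselect (F !=set0); last first.
    by rewrite (_ : F = set0) ?bigcup_set0 ?setU0 //; exact/nonemptyPn.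
  rewrite (_ : _ `|` _ = \bigcup_(Y in [set x `|` Y | Y in F]) Y); last first.
    apply/seteqP; split=> [t [xt|[Y FY Yt]]|t [_ [Y FY <-] [xt|Yt]]].
    - by exists (x `|` X); [exists X|left].
    - by exists (x `|` Y); [exists Y|right].
    - by left.
    - by right; exists Y.
  apply: chainP; first by exists (x `|` X), X.
    by move=> _ [Y FY <-]; exact: FP.
  by move=> _ _ [Y FY <-] [Z FZ <-]; have [YZ|ZY] := totF _ _ FY FZ;
    [left|right]; exact: setUS.
exists (x `|` A); split=> //.
move=> w xAw Pw; apply/seteqP; split=> // t wt.
apply: contrapT => xAt; apply: (maxA w); last first.
  rewrite /mkset (_ : x `|` w = w) //; apply/seteqP; split=> u; last by right.
  by case=> // xu; apply: xAw; left.
split=> [u Au|/(_ _ wt) At]; first by apply: xAw; right.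
by apply: xAt; right.
Qed.

(** If all traces [K]&[f i] were nonempty, they would generate a proper filter, and its cluster
    point in [K] would lie in every closed [f i]. *)
Lemma compact_directed (T : topologicalType) (K : set T) (I : Type)
    (D : set I) (f : I -> set T) : compact K -> D !=set0 ->
  (forall i, D i -> closed (f i)) ->
  (forall i j, D i -> D j -> exists2 k, D k & f k `<=` f i `&` f j) ->
  (forall x, K x -> ~ (forall i, D i -> f i x)) ->
  exists2 i, D i & K `&` f i `<=` set0.
Proof.
move=> cK [i0 Di0] cf dirf Kf0; apply: contrapT => noi.
have KfI i : D i -> (K `&` f i) !=set0.
  by move=> Di; apply: contrapT => /nonemptyPn Kfi; apply: noi; exists i;
    rewrite // Kfi.
have FF : ProperFilter (filter_from D (fun i => K `&` f i)).
  apply: filter_from_proper => //; apply: filter_from_filter; first by exists i0.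
  move=> i j Di Dj; have [k Dk fk] := dirf _ _ Di Dj; exists k => // t [Kt ft].
  by have [] := fk _ ft.
have [|x [Kx clx]] := cK _ FF; first by exists i0 => // t [].
apply: (Kf0 _ Kx) => i Di; apply: (cf _ Di) => B /clx; apply.
by exists i => // t [].
Qed.

(** * Prime filters of a meet semi-lattice *)

Section Filters.
Context {d : Order.disp_t} {L : meetSemilatticeType d}.
Implicit Types (F G : set L) (a b c : L) (s : seq L).

Definition upper_bounds s : set L := [set c | forall b, b \in s -> (b <= c)%O].

Lemma principal_filter a : is_filter [set b | (a <= b)%O].
Proof.
split=> [|b c /= ab bc|b c /= ab ac]; first by exists a => /=.
- exact: le_trans bc.
- by rewrite lexI ab.
Qed.

(** Induction on [s], with properness for the empty list. If every common upper bound of [b] and [c]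
    were in [F], primality applied to the two principal filters would put [b] or [c] in [F]. *)
Lemma prime_filter_upper_bound F s : prime_filter F ->
  (forall b, b \in s -> ~ F b) -> exists2 c, upper_bounds s c & ~ F c.
Proof.
move=> [filF properF primeF]; elim: s => [_|b s IH sF].
  have /existsNP[c Fc] : ~ (forall c, F c).
    by move=> F1; apply: properF; apply/seteqP; split.
  by exists c.
have [b' sb'|c sc Fc] := IH; first by apply: sF; rewrite inE sb' orbT.
apply: contrapT => noub.
have [||] := primeF _ _ (principal_filter b) (principal_filter c).
- move=> e [/= be ce]; apply: contrapT => Fe; apply: noub; exists e => // b'.
  by rewrite inE => /predU1P[->//|/sc /le_trans]; apply.
- by move=> /(_ b (lexx b)); apply: sF; rewrite mem_head.
- by move=> /(_ c (lexx c)).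
Qed.

Lemma directed_prime_filter F : is_filter F -> F <> [set: L] ->
  (forall a b, ~ F a -> ~ F b -> exists c, [/\ ~ F c, (a <= c)%O & (b <= c)%O]) ->
  prime_filter F.
Proof.
move=> filF properF dirF; split=> // F1 F2 [_ up1 _] [_ up2 _] F12.
apply: contrapT => /not_orP[/existsNP[a /not_implyP[F1a Fa]]].
move=> /existsNP[b /not_implyP[F2b Fb]].
have [c [Fc ac bc]] := dirF _ _ Fa Fb.
by apply: Fc; apply: F12; split; [exact: up1 ac|exact: up2 bc].
Qed.

Lemma filter_bigcup (C : set (set L)) : C !=set0 -> C `<=` is_filter ->
  total_on C subset -> is_filter (\bigcup_(F in C) F).
Proof.
move=> [F0 CF0] Cfil totC; split.
- by have [[a F0a] _ _] := Cfil _ CF0; exists a, F0.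
- move=> a b [F CF Fa] ab; exists F => //.
  by have [_ upF _] := Cfil _ CF; exact: upF ab.
- move=> a b [F CF Fa] [G CG Gb]; have [FG|GF] := totC _ _ CF CG.
    by exists G => //; have [_ _] := Cfil _ CG; apply=> //; exact: FG.
  by exists F => //; have [_ _] := Cfil _ CF; apply=> //; exact: GF.
Qed.

Lemma filter_adjoin F a : is_filter F ->
  is_filter [set b | exists2 e, F e & (Order.meet e a <= b)%O].
Proof.
move=> [[e0 Fe0] upF FI]; split=> [|b c [e Fe eb] bc|b c [e Fe eb] [g Fg gc]].
- by exists a, e0 => //; exact: leIr.
- by exists e => //; exact: le_trans bc.
- exists (Order.meet e g); first exact: FI.
  rewrite lexI (le_trans _ eb) ?(le_trans _ gc) ?leI2 //.
  + exact: leIr.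
  + exact: leIl.
Qed.

(* A filter maximal among those avoiding [c] is prime; the two applications of
   distributivity produce [q] above both [f1] and [f2] with [e `&` q <= c]. *)
Lemma prime_filter_avoiding F c : distributive_meet L -> is_filter F -> ~ F c ->
  exists y, [/\ prime_filter y, F `<=` y & ~ y c].
Proof.
move=> distrL filF Fc.
have [||y [Fy [fily yc] maxy]] :=
    @Zorn_above _ [set G | is_filter G /\ ~ G c] F; first by split.
  move=> C C0 CP totC; split; first by apply: filter_bigcup => // G /CP[].
  by move=> [G /CP[_ Gc]].
exists y; split=> //; have [[e0 ye0] upy yI] := fily.
have adj a : ~ y a -> exists2 e, y e & (Order.meet e a <= c)%O.
  move=> ya; apply: contrapT => noe; apply: ya.
  rewrite -(maxy _ _ (conj (filter_adjoin a fily) noe)).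
    by exists e0 => //; exact: leIr.
  by move=> b yb; exists b => //; exact: leIl.
apply: directed_prime_filter => // [yT|f1 f2 yf1 yf2].
  by apply: yc; rewrite yT.
have [e1 ye1 e1c] := adj _ yf1; have [e2 ye2 e2c] := adj _ yf2.
pose e := Order.meet e1 e2; have ye : y e by exact: yI.
have ef1 : (Order.meet e f1 <= c)%O.
  by apply: le_trans e1c; rewrite leI2 ?leIl.
have ef2 : (Order.meet e f2 <= c)%O.
  by apply: le_trans e2c; rewrite leI2 ?leIr.
have [u [v [eu f1v cE]]] := distrL _ _ _ ef1.
have ev : (Order.meet e v <= c)%O by rewrite cE leI2.
have ef2v : (Order.meet e f2 <= v)%O by rewrite (le_trans ef2) // cE leIr.
have [p [q [ep f2q vE]]] := distrL _ _ _ ef2v.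
exists q; split=> //; last by rewrite (le_trans f1v) // vE leIr.
move=> yq; have yv : y v by rewrite vE; exact: yI (upy _ _ ye ep) yq.
by apply: yc; exact: upy (yI _ _ ye yv) ev.
Qed.

Definition finitely_separated G : Prop := forall a s, G a ->
  (forall b, b \in s -> ~ G b) -> exists2 c, upper_bounds s c & ~~ (a <= c)%O.

Lemma prime_finitely_separated F : prime_filter F -> finitely_separated F.
Proof.
move=> primeF a s Fa /(prime_filter_upper_bound primeF)[c sc Fc]; exists c => //.
by apply/negP => ac; apply: Fc; case: primeF => -[_ upF _] _ _; exact: upF ac.
Qed.

(** A prime filter disjoint from [s] misses some upper bound of [s], hence also [a], which lies
    below it. *)
Lemma sigma_sub_bigcup a s : (forall c, upper_bounds s c -> (a <= c)%O) ->
  sigma a `<=` \bigcup_(b in [set` s]) sigma b.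
Proof.
move=> sa y [primey ya]; apply: contrapT => nos.
have [b sb yb|c sc yc] := prime_filter_upper_bound (s := s) primey.
  by apply: nos; exists b.
by apply: yc; case: primey => -[_ upy _] _ _; exact: upy (sa _ sc).
Qed.

End Filters.

(** * Optimal filters and prime filters of [DL] *)

Section OptimalFilters.
Context {d : Order.disp_t} {L : meetSemilatticeType d}.
Implicit Types (F G : set L) (a b c : L) (s : seq L).

Lemma leDL (U V : DL L) : is_true (U <= V)%O = (val U `<=` val V).
Proof. by rewrite leEsub subsetEset. Qed.

(** Otherwise [P] would miss an upper bound in [DL] of all the [sigmaD b]; that bound contains their
    union, hence [U], and so belongs to [P]. *)
Lemma prime_DL_bigcup (P : set (DL L)) s (U : DL L) : prime_filter P -> P U ->
  val U `<=` \bigcup_(b in [set` s]) sigma b ->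
  exists2 b, b \in s & P (sigmaD b).
Proof.
move=> primeP PU Us; apply: contrapT => nos.
have [V|V sV] := prime_filter_upper_bound (s := map (@sigmaD _ L) s) primeP.
  by move=> /mapP[b sb ->] Pb; apply: nos; exists b.
apply; case: primeP => -[_ upP _] _ _; apply: upP PU _.
rewrite leDL; apply: subset_trans Us _ => y [b /= sb yb].
by have := sV _ (map_f (@sigmaD _ L) sb); rewrite leDL; apply.
Qed.

Lemma optimal_finitely_separated G : optimal_filter G -> finitely_separated G.
Proof.
move=> [_ [P primeP ->]] a s Pa sP; apply: contrapT => noc.
have [|b sb Pb] := prime_DL_bigcup (s := s) primeP Pa.
  apply: sigma_sub_bigcup => c sc.
  by apply/negPn/negP => ac; apply: noc; exists c.
exact: sP Pb.
Qed.

Lemma prime_filter_separating a b : distributive_meet L -> ~~ (a <= b)%O ->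
  exists y, [/\ prime_filter y, y a & ~ y b].
Proof.
move=> distrL /negP ab.
have [y [primey ay yb]] := prime_filter_avoiding distrL (principal_filter a) ab.
by exists y; split=> //; apply: ay => /=.
Qed.

(* The prime filter of [DL] is the trace of an ultrafilter containing the sets
   [sigma a] for [a] in [G] and the complements of [sigma b] for [b] not in
   [G]. *)
Lemma finitely_separated_optimal G : distributive_meet L -> is_filter G ->
  finitely_separated G -> optimal_filter G.
Proof.
move=> distrL filG sepG; split=> //; have [[g Gg] upG GI] := filG.
pose D := [set p : L * seq L | G p.1 /\ (forall b, b \in p.2 -> ~ G b)].
pose f (p : L * seq L) : set (set L) :=
  [set y | [/\ prime_filter y, y p.1 & forall b, b \in p.2 -> ~ y b]].
have PF : ProperFilter (filter_from D f).
  apply: filter_from_proper => [|[a s] [/= Ga sG]]; last first.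
    have [c sc ac] := sepG _ _ Ga sG.
    have [y [primey ya yc]] := prime_filter_separating distrL ac.
    exists y; split=> // b sb yb; apply: yc.
    by case: primey => -[_ upy _] _ _; exact: upy (sc _ sb).
  apply: filter_from_filter; first by exists (g, [::]); split.
  move=> [a s] [b t] [/= Ga sG] [/= Gb tG].
  exists (Order.meet a b, s ++ t).
    by split=> [|c] /=; [exact: GI|rewrite mem_cat => /orP[/sG|/tG]].
  move=> y [primey /= yab sty]; have [[_ upy _] _ _] := primey.
  split; split=> //=.
  - by apply: upy yab _; exact: leIl.
  - by move=> c sc; apply: sty; rewrite mem_cat sc.
  - by apply: upy yab _; exact: leIr.
  - by move=> c tc; apply: sty; rewrite mem_cat tc orbT.
have [U [ultraU FU]] := ultraFilterLemma PF.
have U_f p : D p -> U (f p) by move=> Dp; apply: FU; exists p.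
have U_sigma a : G a -> U (sigma a).
  move=> Ga; have /U_f : D (a, [::]) by split.
  by apply: filterS => y [].
exists [set V : DL L | U (val V)]; last first.
  apply/seteqP; split=> a /=; first exact: U_sigma.
  move=> Ua; apply: contrapT => Ga.
  have /U_f Uga : D (g, [:: a]) by split=> // b; rewrite inE => /eqP ->.
  have [y [[_ ya] [_ _ /(_ a)]]] := filter_ex (filterI Ua Uga).
  by rewrite mem_head; apply.
apply: directed_prime_filter.
- split=> [|V W UV|V W UV UW].
  + by exists (sigmaD g); exact: U_sigma.
  + by rewrite leDL => VW; exact: filterS UV.
  + exact: filterI UV UW.
- have DL0 : sigma_unions (set0 : set (set L)).
    by exists [::]; apply/seteqP; split=> // y [].
  move=> UT; pose Z : DL L := exist _ set0 (mem_set DL0).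
  have : [set V : DL L | U (val V)] Z by rewrite UT.
  by move=> /filter_ex[].
- move=> V W UV UW; exists (Order.join V W); split; [|exact: leUl|exact: leUr].
  move=> UVW; have [//|UnV] := in_ultra_setVsetC (val V) ultraU.
  have [//|UnW] := in_ultra_setVsetC (val W) ultraU.
  by have [y [[]]] := filter_ex (filterI UVW (filterI UnV UnW)) => ? [].
Qed.

Lemma prime_optimal F : distributive_meet L -> prime_filter F ->
  optimal_filter F.
Proof.
move=> distrL primeF; apply: finitely_separated_optimal => //.
  by case: primeF.
exact: prime_finitely_separated.
Qed.

End OptimalFilters.

(** * Topology and compactness of the dual space *)

Section DualSpace.
Context {d : Order.disp_t} {L : tbMeetSemilatticeType d}.
Context (distrL : distributive_meet L).
Implicit Types (a b c : L) (s : seq L).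

Local Notation X := (dual_space L).

Lemma dual_pointP (x : X) : optimal_filter (val x).
Proof. exact: set_mem (valP x). Qed.

Lemma dual_filter (x : X) : is_filter (val x).
Proof. by case: (dual_pointP x). Qed.

Definition dual_point (G : set L) (optG : optimal_filter G) : X :=
  exist _ G (mem_set optG).

Lemma clopen_phi a : clopen (phi a : set X).
Proof.
have subbase_open (A : set X) : dual_subbasis A -> open A.
  move=> sbA; exists [set A]; last by rewrite bigcup_set1.
  by move=> _ ->; exact: (@finI_from1 _ _ _ id).
split; first by apply: subbase_open; left; exists a.
by rewrite -[phi a]setCK; apply: open_closedC; apply: subbase_open; right;
  exists a.
Qed.

Lemma phiI a b : phi (Order.meet a b) = (phi a `&` phi b : set X).
Proof.
apply/seteqP; split=> x; have [_ upx xI] := dual_filter x.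
  by move=> xab; split; apply: upx xab _; [exact: leIl|exact: leIr].
by move=> [xa xb]; exact: xI.
Qed.

Lemma phi_upset a : @upset (dual L) (phi a).
Proof. by move=> x y xa /(_ a); apply. Qed.

(** Finitely many sets [phi b] merge into one through meets, so only the complements need a list. *)
Lemma dual_open_basis (x : X) (O : set X) : open O -> O x ->
  exists a s, [/\ phi a x, forall b, b \in s -> ~ phi b x
    & forall y, phi a y -> (forall b, b \in s -> ~ phi b y) -> O y].
Proof.
move=> oO; have [B sB <-] : exists2 B, B `<=` finI_from (@dual_subbasis d L) id
    & \bigcup_(A in B) A = O by exact: oO.
move=> [A BA Ax]; have [E sE AE] := sB _ BA.
suff basis (l : seq (set X)) : (forall S, S \in l -> dual_subbasis S /\ S x) ->
    exists a s, [/\ phi a x, forall b, b \in s -> ~ phi b x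
      & forall y, phi a y -> (forall b, b \in s -> ~ phi b y) ->
          forall S, S \in l -> S y].
  have [S SE|a [s [xa xs asE]]] := basis (finmap.enum_fset E).
    by split; [exact/set_mem/sE|move: Ax; rewrite -AE; exact].
  exists a, s; split=> // y ya ys; exists A => //; rewrite -AE => S SE.
  exact: asE.
elim: l => [_|S l IH lx].
  by have [[a xa] _ _] := dual_filter x; exists a, [::].
have [T lT|a [s [xa xs asl]]] := IH; first by apply: lx; rewrite inE lT orbT.
have [[[b _ bS]|[b _ bS]] Sx] := lx S (mem_head _ _); subst S.
  exists (Order.meet a b), s; rewrite phiI; split=> //.
  by move=> y [ya yb] ys T /predU1P[->//|]; exact: asl.
exists a, (b :: s); split=> // [c /predU1P[->//|]|y ya ys T]; first exact: xs.
move=> /predU1P[->|]; first by apply: ys; rewrite mem_head.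
by apply: asl => // c sc; apply: ys; rewrite inE sc orbT.
Qed.


(** An ultrafilter [F] converges to the point [G] of all [a] with [phi a] in [F]. *)
Lemma compact_dual : compact [set: X].
Proof.
rewrite compact_ultra => F ultraF _; pose G := [set a | F (phi a)].
have FC b : ~ G b -> F (~` phi b).
  by have [|] := in_ultra_setVsetC (phi b) ultraF.
have FCs s : (forall b, b \in s -> ~ G b) ->
    F [set y : X | forall b, b \in s -> ~ phi b y].
  elim: s => [_|b s IH sG]; first by apply: filterS filterT.
  have Fb : F (~` phi b) by apply: FC; apply: sG; rewrite mem_head.
  have Fs : F [set y : X | forall b, b \in s -> ~ phi b y].
    by apply: IH => c sc; apply: sG; rewrite inE sc orbT.
  by apply: filterS (filterI Fb Fs) => y [yb ys] c /predU1P[->//|/ys].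
have optG : optimal_filter G.
  apply: finitely_separated_optimal => //.
    split=> [|a b Ga ab|a b Ga Gb].
    - exists Order.top; apply: filterS filterT => x _.
      by have [[a xa] upx _] := dual_filter x; exact: upx (lex1 a).
    - apply: filterS Ga => x xa; have [_ upx _] := dual_filter x.
      exact: upx ab.
    - by rewrite /G /= phiI; exact: filterI.
  (* Each instance of finite separation involves finitely many members of [F]; a point [x] common to
     them provides the required upper bound. *)
  move=> a s Ga sG; have [x [xa xs]] := filter_ex (filterI Ga (FCs _ sG)).
  exact: optimal_finitely_separated (dual_pointP x) _ _ xa xs.
exists (dual_point optG); split=> // A; rewrite nbhsE => -[V [oV VG] VA].
have [a [s [Ga sG asV]]] := dual_open_basis oV VG.
by apply: filterS (filterI Ga (FCs _ sG)) => y [ya ys]; apply: VA; exact: asV.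
Qed.

(** * The embedding [phi] into the clopen upsets *)

Lemma phi_le a b : (phi a : set X) `<=` phi b -> (a <= b)%O.
Proof.
move=> ab; apply/negPn/negP => /(prime_filter_separating distrL).
move=> [y [primey ya yb]]; apply: yb.
exact: (ab (dual_point (prime_optimal distrL primey))).
Qed.

Lemma phi_inj a b : phi a = phi b :> set X -> a = b.
Proof. by move=> ab; apply/le_anti/andP; split; apply: phi_le; rewrite ab. Qed.

Lemma phi_top : phi \top%O = [set: X].
Proof.
apply/seteqP; split=> // x _; have [[a xa] upx _] := dual_filter x.
exact: upx (lex1 a).
Qed.

Lemma phi_bottom : phi \bot%O = set0 :> set X.
Proof.
apply/seteqP; split=> // x x0.
(* For empty [s], finite separation would give an element not above the bottom. *)
have [//|c _] := optimal_finitely_separated (dual_pointP x) (s := [::]) x0.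
by rewrite le0x.
Qed.

Lemma prime_point_avoiding (x : X) a : ~ phi a x ->
  exists y : X, [/\ prime_filter (val y : set L), (val x : set L) `<=` val y
    & ~ phi a y].
Proof.
move=> xa; have [y [primey xy ya]] :=
  prime_filter_avoiding distrL (dual_filter x) xa.
by exists (dual_point (prime_optimal distrL primey)).
Qed.

(** A point missing [a] extends to a prime filter missing [a]; a maximal one equals that
    extension. *)
Lemma star_phi a : star (phi a : set (dual L)).
Proof.
split; [exact: clopen_phi|exact: phi_upset|move=> x [xa maxx]].
have [y [primey xy ya]] := prime_point_avoiding xa.
by rewrite -(maxx y).
Qed.

(** * Clopen upsets and the image of [phi] *)

Lemma clopen_upset_union (U : set X) : clopen U -> @upset (dual L) U ->
  exists s, U = \bigcup_(b in [set` s]) phi b.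
Proof.
move=> [oU cU] upU.
have phi_in x : U x -> exists2 a, phi a x & phi a `<=` U.
  move=> Ux.
  (* The [phi a] with [a] in [x] intersect in the points above [x], all of which lie in [U];
     compactness of the complement selects a single [a]. *)
  have [| | | | |a xa aU] := @compact_directed X (~` U) L (val x) (@phi _ L).
  - by apply: subclosed_compact compact_dual _ => //; exact: open_closedC.
  - by case: (dual_filter x).
  - by move=> a _; case: (clopen_phi a).
  - move=> a b xa xb; exists (Order.meet a b); last by rewrite phiI.
    by have [_ _] := dual_filter x; apply.
  - by move=> y Uy xy; apply: Uy; exact: upU Ux xy.
  - by exists a => // y ya; apply: contrapT => Uy; exact: (aU y).
pose D := [set s : seq L | forall b, b \in s -> phi b `<=` U].
(* Finite subcover of [U], phrased with the complements of finite unions, which are directed under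
   concatenation of lists. *)
have [| | | | |s sU Us] := @compact_directed X U _ D
    (fun s => \bigcap_(b in [set` s]) ~` phi b).
- exact: subclosed_compact compact_dual _.
- by exists [::].
- move=> s _; apply: closed_bigI => b _; apply: open_closedC.
  by case: (clopen_phi b).
- move=> s t sU tU; exists (s ++ t).
    by move=> b; rewrite mem_cat => /orP[/sU|/tU].
  by move=> x stx; split=> b /= sb; apply: stx; rewrite /= mem_cat sb ?orbT.
- move=> x Ux; have [a xa aU] := phi_in _ Ux.
  have Da : D [:: a] by move=> b; rewrite inE => /eqP ->.
  by move=> /(_ _ Da) /(_ a (mem_head _ _)).
exists s; apply/seteqP; split=> [x Ux|x [b sb]]; last exact: sU.
apply: contrapT => sx; apply: (Us x); split=> // b sb xb; apply: sx.
by exists b.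
Qed.

Lemma maximal_above s (x : X) : (forall b, b \in s -> ~ phi b x) ->
  exists2 z : X, (val x : set L) `<=` val z
    & @maximal (dual L) (~` \bigcup_(b in [set` s]) phi b) z.
Proof.
move=> sx.
have [||z [xz [optz sz] maxz]] := @Zorn_above L
    [set G | optimal_filter G /\ forall b, b \in s -> ~ G b] (val x).
- by split=> //; exact: dual_pointP.
- move=> C C0 CP totC; split; last by move=> b sb [G /CP[_ /(_ _ sb)]].
  apply: finitely_separated_optimal => //.
    by apply: filter_bigcup => // G /CP[[]].
  (* Separation concerns one element [a] of the union, so the member [G] of the chain containing [a]
     already supplies the upper bound. *)
  move=> a t [G CG Ga] tC; have [optG _] := CP _ CG.
  apply: (optimal_finitely_separated optG Ga) => b tb Gb.
  by apply: (tC b tb); exists G.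
exists (dual_point optz) => //; split=> [[b sb]|y sy zy]; first exact: sz.
apply: val_inj; apply: maxz => //; split; first exact: dual_pointP.
by move=> b sb yb; apply: sy; exists b.
Qed.

Lemma star_range (U : set (dual L)) : star U -> exists a, U = phi a.
Proof.
move=> [clU upU maxU]; have [s Us] := clopen_upset_union clU upU.
have [oU cU] := clU.
have [| | | | |c sc cU'] := @compact_directed X (~` U) L (upper_bounds s)
    (@phi _ L).
- by apply: subclosed_compact compact_dual _ => //; exact: open_closedC.
- by exists \top%O => b _; exact: lex1.
- by move=> a _; case: (clopen_phi a).
- move=> a b sa sb; exists (Order.meet a b); last by rewrite phiI.
  by move=> c sc; rewrite lexI sa ?sb.
- move=> x Ux.
  (* A maximal point [z] above [x] is prime by the condition on [U], so it misses an upper bound of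
     [s], and [x], being smaller, misses it too. *)
  have [|z xz maxz] := @maximal_above s x.
    by move=> b sb xb; apply: Ux; rewrite Us; exists b.
  have primez : prime_filter (val z : set L) by apply: maxU; rewrite Us.
  have [b sb zb|c sc zc] := prime_filter_upper_bound (s := s) primez.
    by case: maxz => + _; apply; exists b.
  by move=> /(_ c sc) xc; apply: zc; exact: xz.
exists c; apply/seteqP; split=> x.
  rewrite Us => -[b sb xb]; have [_ upx _] := dual_filter x.
  exact: upx (sc _ sb).
by move=> xc; apply: contrapT => Ux; exact: (cU' x).
Qed.

(** * Axioms of a generalized Priestley space, and the isomorphism *)

Lemma Priestley_dual : Priestley_space (dual L).
Proof.
split; first exact: compact_dual.
  split=> [x|x y xy yx|x y z]; [exact: subset_refl| |exact: subset_trans].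
  by apply: val_inj; apply/seteqP.
move=> x y /existsNP[a /not_implyP[xa ya]].
by exists (phi a); split=> //; [exact: clopen_phi|exact: phi_upset].
Qed.

(** Finite separation at a point of a basic open set gives an upper bound [c] of [s] not above [a];
    a prime filter with [a] but not [c] then lies in that set. *)
Lemma dense_prime : dense [set x : X | prime_filter (val x : set L)].
Proof.
move=> O [x Ox] oO; have [a [s [xa xs asO]]] := dual_open_basis oO Ox.
have [c sc ac] := optimal_finitely_separated (dual_pointP x) xa xs.
have [y [primey ya yc]] := prime_filter_separating distrL ac.
exists (dual_point (prime_optimal distrL primey)); split=> //.
have [[_ upy _] _ _] := primey.
by apply: asO => // b sb yb; apply: yc; exact: upy (sc _ sb).
Qed.

Lemma generalized_Priestley_dual : generalized_Priestley_space (dual L).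
Proof.
have notbot (x : X) : ~ phi \bot%O x by rewrite phi_bottom.
split; [exact: Priestley_dual|exact: dense_prime|..].
- move=> x; have [y [primey xy _]] := prime_point_avoiding (@notbot x).
  by exists y.
- move=> x; split=> [primex U V [/star_range[a ->] xa] [/star_range[b ->] xb]|].
    have [c|c sc xc] := prime_filter_upper_bound (s := [:: a; b]) primex.
      by rewrite !inE => /orP[] /eqP ->.
    exists (phi c); first by split=> //; exact: star_phi.
    move=> y; have [_ upy _] := dual_filter y; case=> yab.
      by apply: upy yab _; apply: sc; rewrite !inE eqxx.
    by apply: upy yab _; apply: sc; rewrite !inE eqxx orbT.
  (* As every member of [star] is some [phi c] and [phi] reflects the order, directedness of the
     avoiding sets becomes directedness of the complement of [x] in [L]. *)
  move=> dirx; apply: directed_prime_filter; first exact: dual_filter.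
    by move=> xT; apply: (@notbot x); rewrite /phi /= xT.
  move=> a b xa xb.
  have [||W [/star_range[c ->] xc] abc] := dirx (phi a) (phi b).
  + by split=> //; exact: star_phi.
  + by split=> //; exact: star_phi.
  + by exists c; split=> //; apply: phi_le => y yab; apply: abc; [left|right].
- move=> x y; split=> [xy U [_ upU _] Ux|xy a xa]; first exact: upU Ux xy.
  exact: (xy _ (star_phi a)).
Qed.

Lemma iso_star_dual : iso_star (dual L) L.
Proof.
exists (@phi _ L); split=> [|a b| |].
- split=> [a _|a b _ _|U /star_range[a ->]]; first exact: star_phi.
    exact: phi_inj.
  by exists a.
- exact: phiI.
- exact: phi_top.
- exact: phi_bottom.
Qed.

End DualSpace.

Theorem theorem6p13 (d : Order.disp_t) (L : tbMeetSemilatticeType d)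
    (distrL : distributive_meet L) :
  generalized_Priestley_space (dual L) /\ iso_star (dual L) L.
Proof.
split; [exact: generalized_Priestley_dual|exact: iso_star_dual].
Qed.
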